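(* Let $q=p^k$ with $p$ an odd prime. Let $A,B,C\in\mathbb{F}_q$ with $A\neq0$, $B\neq 0$, $A^3\neq -1$, $B^3\neq -1$, $C^2-AB-C+1=0$, $AB-C\neq 0$, $A+B+1\neq 0$, $A^2-AB-A+B^2-B+1\neq 0$, and such that the polynomial $m_{A,B,C}(t)=Ct^3+(AC+A-B^2)t^2+(A^2-BC-B)t-C\in\mathbb{F}_q[t]$ has no roots in $\mu_{q^2+q+1}$. Then $$f(x)=x^{q^2+q-1}+Ax^{q^2}+Bx^{q}+Cx$$ is a permutation polynomial of $\mathbb{F}_{q^3}$.
   Context: $\mu_{q^2+q+1}=\{x\in\mathbb{F}_{q^3}: x^{q^2+q+1}=1\}$. A polynomial $f\in\mathbb{F}_{q^3}[x]$ is a permutation polynomial of $\mathbb{F}_{q^3}$ if $c\mapsto f(c)$ is a bijection of $\mathbb{F}_{q^3}$. *)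

(* Defs.v *)
From HB Require Import structures.
From mathcomp Require Import all_boot all_order all_algebra all_field.

Set Implicit Arguments.
Unset Strict Implicit.
Unset Printing Implicit Defensive.

Import GRing.Theory.
Local Open Scope ring_scope.

Definition permutation_poly (L : fieldType) (f : {poly L}) : Prop :=
  bijective (fun c : L => f.[c]).

Definition mu (L : fieldType) (n : nat) : {pred L} := [pred x : L | x ^+ n == 1].

Arguments mu : clear implicits.

Definition m_poly (F : fieldType) (A B C : F) : {poly F} :=
  C *: 'X^3 + (A * C + A - B ^+ 2) *: 'X^2 + (A ^+ 2 - B * C - B) *: 'X - C%:P.

(* The subtraction in the exponent is on nat; it does not truncate for q > 0. *)
Definition f_poly (F : fieldType) (L : fieldExtType F) (q : nat) (A B C : F) :
    {poly L} :=
  'X^(q ^ 2 + q - 1) + A%:A *: 'X^(q ^ 2) + B%:A *: 'X^q + C%:A *: 'X.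

(* Main.v *)
Require Import Defs.
From HB Require Import structures.
From mathcomp Require Import all_boot all_order all_algebra all_field.
From mathcomp Require Import ring.

Set Implicit Arguments.
Unset Strict Implicit.
Unset Printing Implicit Defensive.

Import GRing.Theory.
Local Open Scope ring_scope.

(* Write [phi x = x ^+ q], [Tr x = x + phi x + phi^2 x] and, for nonzero [x] with
   inverse [X], [f x = Q X / N X], where [N] is the norm and
   [Q X = X^2 + A X phi X + B X phi^2 X + C phi X phi^2 X].
   A nonzero zero of [Q] gives the root [X / phi X] of [m_poly A B C] in [mu], so
   [Q] is anisotropic.  The relation [C^2 - C + 1 = A B] gives the three
   conjugates of [Q] two linear syzygies: for [Tr e = 0] there is an
   F_q-linear map [syz e] with [Tr (syz e X * f x) = 0].  Let [syz_adj e] be the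
   adjoint of [syz e] for the trace form.
   If [f x = f x' = a <> 0] with [X], [X'] not F_q-proportional, then [syz_adj e a]
   runs in the line orthogonal to [X] and [X'] while [e] runs in a plane, so
   [syz_adj e a = 0] for some [e <> 0].  Then [syz e] is not onto, hence has a
   nonzero kernel vector, and that vector is a zero of [Q]: a contradiction.  If [X]
   and [X'] are proportional, F_q-homogeneity of [f] gives [x = x']. *)

(** * Trace identities for an automorphism whose cube is the identity *)

Section CyclicCubic.

Variables (L : fieldType) (phi : {rmorphism L -> L}) (A B C : L).
Hypothesis phi3 : forall x, phi (phi (phi x)) = x.
Hypotheses (phiA : phi A = A) (phiB : phi B = B) (phiC : phi C = C).
Hypothesis ABC : C ^+ 2 - A * B - C + 1 = 0.

Let phiE := (rmorphD phi, rmorphN phi, rmorphM phi, rmorphXn phi, rmorph1 phi,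
  phi3, phiA, phiB, phiC).

Definition cyc_trace x := x + phi x + phi (phi x).

Definition quad_form X :=
  X ^+ 2 + A * X * phi X + B * X * phi (phi X) + C * phi X * phi (phi X).

Definition cyc_map x :=
  phi x * phi (phi x) / x + A * phi (phi x) + B * phi x + C * x.

Definition syz e X :=
  A * e * phi (phi X) - (C * phi (phi e) + phi e) * phi X.

Definition syz_adj e a :=
  A * phi a * phi e - phi (phi a) * (C * phi e + e).

Lemma syz_adjE e X a : cyc_trace (syz e X * a) = cyc_trace (syz_adj e a * X).
Proof. by rewrite /cyc_trace /syz /syz_adj !phiE; ring. Qed.

Lemma syzB e : {morph syz e : X Y / X - Y}.
Proof. by move=> X Y; rewrite /syz !phiE; ring. Qed.

Lemma syz_adjB e e' a : syz_adj (e - e') a = syz_adj e a - syz_adj e' a.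
Proof. by rewrite /syz_adj !phiE; ring. Qed.

Lemma cyc_traceB x y : cyc_trace (x - y) = cyc_trace x - cyc_trace y.
Proof. by rewrite /cyc_trace !phiE; ring. Qed.

Lemma cyc_traceZ l x : phi l = l -> cyc_trace (l * x) = l * cyc_trace x.
Proof. by move=> lP; rewrite /cyc_trace !phiE !lP; ring. Qed.

Lemma syz_adjZ l e a : phi l = l -> syz_adj (l * e) a = l * syz_adj e a.
Proof. by move=> lP; rewrite /syz_adj !phiE !lP; ring. Qed.

Lemma cyc_mapZ l x : phi l = l -> cyc_map (l * x) = l * cyc_map x.
Proof.
move=> lP; have [->|l0] := eqVneq l 0.
  by rewrite /cyc_map !mul0r !rmorph0; ring.
have [->|x0] := eqVneq x 0.
  by rewrite /cyc_map !mulr0 !rmorph0; ring.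
by rewrite /cyc_map !phiE !lP; field; rewrite x0.
Qed.

(** Once [phi (phi e)] is eliminated by the trace condition, the left side is a multiple of
    [C ^+ 2 - A * B - C + 1], which vanishes. *)
Lemma syz_quad_form e X :
  cyc_trace e = 0 -> cyc_trace (syz e X * quad_form X) = 0.
Proof.
rewrite /cyc_trace /syz /quad_form => tre; rewrite !phiE.
have -> : phi (phi e) = - e - phi e by rewrite -[LHS]subr0 -tre; ring.
set e1 := e; set e2 := phi e; set Y := phi X; set Z := phi Y.
transitivity (- (C ^+ 2 - A * B - C + 1) *
   ((- e1 - e2) * Y ^+ 2 * Z + e1 * Z ^+ 2 * X + e2 * X ^+ 2 * Y)); first by ring.
by rewrite ABC oppr0 mul0r.
Qed.

Lemma cyc_mapV (X : L) : X != 0 ->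
  cyc_map X^-1 = (X * phi X * phi (phi X))^-1 * quad_form X.
Proof.
move=> X0; rewrite /cyc_map /quad_form !fmorphV.
by field; rewrite !fmorph_eq0 X0 oner_eq0.
Qed.

Lemma syz_cyc_map e x : cyc_trace e = 0 -> x != 0 ->
  cyc_trace (syz_adj e (cyc_map x) * x^-1) = 0.
Proof.
move=> tre x0; rewrite -syz_adjE -{2}[x]invrK cyc_mapV ?invr_eq0 // mulrCA.
(* The inverse norm is fixed by [phi], which permutes its factors, so it leaves the trace as a
   scalar. *)
rewrite cyc_traceZ.
  by rewrite syz_quad_form ?mulr0.
by move: x^-1 => X; rewrite fmorphV !phiE; congr (_ ^-1); ring.
Qed.

Lemma syz_eq0_quad_form e X : A != 0 -> e != 0 -> cyc_trace e = 0 ->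
  syz e X = 0 -> quad_form X = 0.
Proof.
move=> A0 e0 tre E1; have := congr1 phi E1; rewrite rmorph0 => E2.
(* This conjugate, multiplied by [e * A], is a combination of [syz e X], its image under [phi], the
   trace of [e] and the relation [ABC]. *)
suff Q3 : phi (phi (quad_form X)) = 0 by rewrite -[LHS]phi3 Q3 rmorph0.
apply: (mulfI (mulf_neq0 e0 A0)); rewrite mulr0.
move: E1 E2 tre; rewrite /cyc_trace /syz /quad_form !phiE => E1 E2 tre.
transitivity ((phi (phi X) + A * X) *
  (A * e * phi (phi X) - (C * phi (phi e) + phi e) * phi X
   + C * phi X * (e + phi e + phi (phi e)))
  - (C - 1) * phi X *
   (A * phi e * X - (C * e + phi (phi e)) * phi (phi X)
   + phi (phi X) * (e + phi e + phi (phi e)))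
  - e * phi X * phi (phi X) * (C ^+ 2 - A * B - C + 1)); first by ring.
by rewrite E1 E2 tre ABC; ring.
Qed.

(* Both [w] and [w'] lie in the line orthogonal to the plane spanned by [x], [x']. *)
Lemma trace_orthogonal_proportional x x' w w' :
    x * phi x' != x' * phi x ->
    cyc_trace (w * x) = 0 -> cyc_trace (w * x') = 0 ->
    cyc_trace (w' * x) = 0 -> cyc_trace (w' * x') = 0 ->
  w * phi w' = w' * phi w.
Proof.
rewrite /cyc_trace !phiE => xx' wx wx' w'x w'x'.
(* Under [phi] the claim becomes the vanishing of a minor of the conjugate vectors of [w] and [w'].
   Its product with the nonzero minor of [x] and [x'] is, up to sign, a combination of the four
   trace equations. *)
apply/eqP; rewrite -subr_eq0 -(fmorph_eq0 phi) !phiE.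
move: xx'; rewrite -subr_eq0 => xx'.
rewrite -(mulrI_eq0 _ (mulfI xx')) -oppr_eq0.
set x2 := phi x in wx w'x *; set x2' := phi x' in wx' w'x' *.
set w2 := phi w in wx wx' *; set w2' := phi w' in w'x w'x' *.
set x3 := phi x2 in wx w'x; set x3' := phi x2' in wx' w'x'.
set w3 := phi w2 in wx wx' *; set w3' := phi w2' in w'x w'x' *.
apply/eqP; transitivity
  (x' * (w3' * (w * x + w2 * x2 + w3 * x3) - w3 * (w' * x + w2' * x2 + w3' * x3))
   - x * (w3' * (w * x' + w2 * x2' + w3 * x3') -
          w3 * (w' * x' + w2' * x2' + w3' * x3'))); first by ring.
by rewrite wx wx' w'x w'x'; ring.
Qed.

(** * Injectivity of [cyc_map] when [quad_form] is anisotropic *)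

Hypothesis A_neq0 : A != 0.
Hypothesis inj_surj : forall g : L -> L, injective g -> forall y, exists x, g x = y.
Hypothesis trace_nondeg : forall a, (forall c, cyc_trace (c * a) = 0) -> a = 0.
Hypothesis trace0_plane : exists e e',
  [/\ cyc_trace e = 0, cyc_trace e' = 0 & e * phi e' != e' * phi e].
Hypothesis quad_form_anisotropic : forall X, quad_form X = 0 -> X = 0.

Lemma cyc_map_eq0 x : cyc_map x = 0 -> x = 0.
Proof.
have [//|x0] := eqVneq x 0; rewrite -[x in cyc_map x]invrK cyc_mapV ?invr_eq0 //.
move/eqP; rewrite mulf_eq0 invr_eq0 !mulf_eq0 !fmorph_eq0 !invr_eq0 !(negPf x0) /=.
by move=> /eqP/quad_form_anisotropic/eqP; rewrite invr_eq0 (negPf x0).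
Qed.

(** If [syz_adj e a] vanished, [a] would be trace-orthogonal to the image of [syz e]. By anisotropy
    [syz e] is injective, hence onto, and this would force [a = 0]. *)
Lemma syz_adj_neq0 e a : e != 0 -> cyc_trace e = 0 -> a != 0 -> syz_adj e a != 0.
Proof.
move=> e0 tre; apply: contraNneq => sa0; apply/eqP/trace_nondeg => c.
have syz_inj : injective (syz e).
  move=> X Y /eqP; rewrite -subr_eq0 -syzB => /eqP /(syz_eq0_quad_form A_neq0 e0 tre).
  by move/quad_form_anisotropic/eqP; rewrite subr_eq0 => /eqP.
have [X <-] := inj_surj syz_inj c.
by rewrite syz_adjE sa0 mul0r /cyc_trace !rmorph0 !addr0.
Qed.

Lemma cyc_map_inj : injective cyc_map.
Proof.
move=> x x' eq_f; have [a0|a0] := eqVneq (cyc_map x) 0.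
  by rewrite [LHS]cyc_map_eq0 // [RHS]cyc_map_eq0 // -eq_f.
have x0 : x != 0 by apply: contra_neq a0 => ->; rewrite /cyc_map !rmorph0; ring.
have x'0 : x' != 0.
  by apply: contra_neq a0; rewrite eq_f => ->; rewrite /cyc_map !rmorph0; ring.
(* This tests whether the inverses of [x] and [x'] are proportional over the fixed field of
   [phi]. *)
have [prop|indep] := eqVneq (x^-1 * phi x'^-1) (x'^-1 * phi x^-1).
  pose l := x / x'.
  have lP : phi l = l.
    rewrite /l rmorphM fmorphV; rewrite !fmorphV in prop.
    transitivity (x * phi x * (x^-1 * (phi x')^-1)).
      by field; rewrite fmorph_eq0 x0 x'0.
    by rewrite prop; field; rewrite fmorph_eq0 x0 x'0.
  have xl : x = l * x' by rewrite divfK.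
  move: (eq_f); rewrite {1}xl cyc_mapZ // -{2}[cyc_map x']mul1r => /mulIf l1.
  by rewrite xl l1 ?mul1r // -eq_f.
have [e [e' [tre tre' ee']]] := trace0_plane.
set a := cyc_map x in eq_f a0.
have e'0 : e' != 0 by apply: contra_neq ee' => ->; rewrite rmorph0 mulr0 mul0r.
have we' := syz_adj_neq0 e'0 tre' a0.
have := trace_orthogonal_proportional indep
  (syz_cyc_map tre x0) _ (syz_cyc_map tre' x0) _.
rewrite -/a eq_f => /(_ (syz_cyc_map tre x'0) (syz_cyc_map tre' x'0)).
rewrite -eq_f => ww'.
(* By [ww'] this ratio is fixed by [phi], so by linearity [syz_adj] kills the trace-zero element
   [e - l * e'] against [a]. *)
pose l := syz_adj e a / syz_adj e' a.
have lP : phi l = l.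
  have pw : phi (syz_adj e' a) != 0 by rewrite fmorph_eq0.
  rewrite /l rmorphM fmorphV; apply: (mulIf pw); apply: (mulIf we').
  by rewrite divfK // mulrAC divfK // mulrC -ww'.
have e_neq : e - l * e' != 0.
  rewrite subr_eq0; apply: contra_neq ee' => ->; rewrite rmorphM lP; ring.
have := syz_adj_neq0 e_neq _ a0; rewrite cyc_traceB cyc_traceZ // tre tre' mulr0 subr0.
by rewrite syz_adjB syz_adjZ // divfK // subrr eqxx => /(_ erefl).
Qed.

End CyclicCubic.

(** * The [q]-power Frobenius on a field of [q ^ 3] elements *)

Section FrobeniusCubic.

Variables (K : finFieldType) (p k q : nat).
Hypotheses (p_prime : prime p) (q_def : q = (p ^ k)%N) (q_gt1 : (1 < q)%N).
Hypotheses (pcharK : p \in [pchar K]) (cardK : #|K| = (q ^ 3)%N).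

(** As [1 < q], the polynomial has coefficient [a] at ['X], so it is nonzero. Its degree is at most
    [q ^ 2], too small for [q ^ 3] roots. *)
Lemma linearized_nonroot (a b c : K) : a != 0 ->
  exists x, a * x + b * x ^+ q + c * x ^+ (q ^ 2) != 0.
Proof.
move=> a0; apply/existsP/contraT; rewrite negb_exists => /forallP all0.
pose P := a *: 'X + b *: 'X^q + c *: 'X^(q ^ 2).
have P0 : P != 0.
  apply: contra_neq a0 => /(congr1 (fun Q : {poly K} => Q`_1)).
  rewrite !coefD !coefZ coefX !coefXn coef0 eqxx (ltn_eqF q_gt1).
  rewrite (ltn_eqF (ltn_trans q_gt1 (ltn_Pmull q_gt1 (ltnW q_gt1)))).
  by rewrite !mulr0 !addr0 mulr1.
have q_lt : (q < q ^ 2)%N by rewrite -[X in (X < _)%N]expn1 ltn_exp2l.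
have sP : (size P <= (q ^ 2).+1)%N.
  rewrite (leq_trans (size_polyD _ _)) // geq_max; apply/andP; split.
    rewrite (leq_trans (size_polyD _ _)) // geq_max.
    rewrite !(leq_trans (size_scale_leq _ _)) ?size_polyX ?size_polyXn ?ltnS 1?ltnW //.
    exact: ltn_trans q_gt1 q_lt.
  by rewrite (leq_trans (size_scale_leq _ _)) ?size_polyXn.
have roots : all (root P) (enum K).
  apply/allP => x _; have := all0 x; rewrite negbK => /eqP Px.
  by rewrite /root /P !hornerE Px.
have := max_poly_roots P0 roots (enum_uniq K); rewrite -cardE cardK.
by rewrite ltnNge (leq_trans sP) // ltn_exp2l.
Qed.

Lemma frobenius_additive : zmod_morphism (fun x : K => x ^+ q).
Proof.
have qnat : [pchar K].-nat q.
  by rewrite q_def pnatX (eq_pnat _ (pcharf_eq pcharK)) pnat_id.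
by move=> x y; rewrite exprDn_pchar // exprNn_pchar.
Qed.

Lemma frobenius_multiplicative : monoid_morphism (fun x : K => x ^+ q).
Proof. by split=> [|x y]; rewrite ?expr1n ?exprMn. Qed.

Definition frobenius_rmorphism : {rmorphism K -> K} :=
  HB.pack (fun x : K => x ^+ q)
    (GRing.isZmodMorphism.Build K K _ frobenius_additive)
    (GRing.isMonoidMorphism.Build K K _ frobenius_multiplicative).

Local Notation phi := frobenius_rmorphism.

Lemma frobeniusE x : phi x = x ^+ q. Proof. by []. Qed.

Lemma frobenius2E x : phi (phi x) = x ^+ (q ^ 2).
Proof. by rewrite !frobeniusE -exprM. Qed.

Lemma frobenius3 x : phi (phi (phi x)) = x.
Proof. by rewrite !frobeniusE -!exprM mulnA -(expnSr q 2) -cardK expf_card. Qed.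

(** The trace of [c * a] is a linearized polynomial in [c] whose linear coefficient is [a]. *)
Lemma frobenius_trace_nondeg a :
  (forall c, cyc_trace phi (c * a) = 0) -> a = 0.
Proof.
move=> tr0; apply/eqP/contraT => a0.
have [x /eqP[]] := linearized_nonroot (phi a) (phi (phi a)) a0.
rewrite -frobenius2E -frobeniusE -[RHS](tr0 x) /cyc_trace !rmorphM.
by ring.
Qed.

Lemma frobenius_trace0_plane : exists e e',
  [/\ cyc_trace phi e = 0, cyc_trace phi e' = 0 & e * phi e' != e' * phi e].
Proof.
have trD x : cyc_trace phi (phi x - x) = 0.
  by rewrite /cyc_trace !rmorphB frobenius3; ring.
have N10 : -1 != 0 :> K by rewrite oppr_eq0 oner_eq0.
have [x xP] := linearized_nonroot 1 0 N10.
have e0 : phi x - x != 0.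
  by apply: contra_neq xP; rewrite frobeniusE => {2}<-; rewrite mul0r; ring.
move: (phi x - x) (trD x) e0 => e tre e0.
have Npe0 : - phi e != 0 by rewrite oppr_eq0 fmorph_eq0.
(* These coefficients are those of the minor of [phi y - y] and [e], seen as a linearized polynomial
   in [y]. *)
have [y yP] := linearized_nonroot (phi e + e) (- e) Npe0.
exists (phi y - y), e; split=> //.
apply: contra_neq yP; rewrite -frobenius2E -frobeniusE rmorphB => yP.
transitivity ((phi y - y) * phi e - e * (phi (phi y) - phi y)); first by ring.
by rewrite yP subrr.
Qed.

Lemma frobenius_quad_form_anisotropic (A B C : K) :
    phi A = A -> phi B = B -> phi C = C ->
    (forall t, t ^+ (q ^ 2 + q + 1) = 1 ->
       C * t ^+ 3 + (A * C + A - B ^+ 2) * t ^+ 2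
         + (A ^+ 2 - B * C - B) * t - C != 0) ->
  forall X, quad_form phi A B C X = 0 -> X = 0.
Proof.
move=> phiA phiB phiC noroot X QX; apply/eqP/contraT => X0.
have := congr1 phi QX; move: QX.
rewrite rmorph0 /quad_form !rmorphD !rmorphM rmorphXn frobenius3 phiA phiB phiC.
move=> Q1 Q2.
have Y0 : phi X != 0 by rewrite fmorph_eq0.
have Z0 : phi (phi X) != 0 by rewrite fmorph_eq0.
(* This power is the norm of [X / phi X], a telescoping product. *)
have tmu : (X / phi X) ^+ (q ^ 2 + q + 1) = 1.
  rewrite 2!exprD -frobenius2E -frobeniusE expr1 !rmorphM !fmorphV frobenius3.
  by field; rewrite X0 Y0 Z0.
case/eqP: (noroot _ tmu); apply: (mulIf (expf_neq0 3 Y0)); rewrite mul0r.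
(* Both [quad_form X] and its image under [phi] are linear in [phi (phi X)]. Eliminating that
   conjugate leaves [phi X ^+ 3] times the cubic at [X / phi X]. *)
transitivity ((A * phi X + C * X) *
    (X ^+ 2 + A * X * phi X + B * X * phi (phi X) + C * phi X * phi (phi X))
  - (B * X + C * phi X) *
    (phi X ^+ 2 + A * phi X * phi (phi X) + B * phi X * X + C * phi (phi X) * X)).
  by field.
by rewrite Q1 Q2; ring.
Qed.

Lemma frobenius_map_bij (A B C : K) :
    A ^+ q = A -> B ^+ q = B -> C ^+ q = C -> A != 0 ->
    C ^+ 2 - A * B - C + 1 = 0 ->
    (forall t, t ^+ (q ^ 2 + q + 1) = 1 ->
       C * t ^+ 3 + (A * C + A - B ^+ 2) * t ^+ 2
         + (A ^+ 2 - B * C - B) * t - C != 0) ->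
  bijective (fun x => x ^+ (q ^ 2 + q - 1) + A * x ^+ (q ^ 2) + B * x ^+ q + C * x).
Proof.
move=> phiA phiB phiC A0 ABC noroot; apply: injF_bij.
have inj_surj (g : K -> K) : injective g -> forall y, exists x, g x = y.
  by move=> /injF_bij[h _ gK] y; exists (h y); rewrite gK.
apply: (eq_inj (cyc_map_inj frobenius3 phiA phiB phiC ABC A0 inj_surj
  frobenius_trace_nondeg frobenius_trace0_plane
  (frobenius_quad_form_anisotropic phiA phiB phiC noroot))) => x.
rewrite /cyc_map frobenius2E frobeniusE; congr (_ + _ + _ + _).
(* At zero the convention [0^-1 = 0] kills the quotient in [cyc_map], and the power vanishes too
   because its exponent is positive. *)
have [->|x0] := eqVneq x 0.
  by rewrite invr0 mulr0 expr0n subn_eq0 leqNgt ltn_addl.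
apply: (mulIf x0); rewrite divfK // -exprD -exprSr subn1 prednK ?(addnC q) //.
by rewrite addn_gt0 (ltnW q_gt1) orbT.
Qed.

End FrobeniusCubic.

Lemma horner_m_poly (F : fieldType) (L : fieldExtType F) (A B C : F) (t : L) :
  (map_poly (in_alg L) (m_poly A B C)).[t] =
    C%:A * t ^+ 3 + (A%:A * C%:A + A%:A - B%:A ^+ 2) * t ^+ 2
      + (A%:A ^+ 2 - B%:A * C%:A - B%:A) * t - C%:A.
Proof.
rewrite /m_poly rmorphB !rmorphD /= !map_polyZ !map_polyXn map_polyX map_polyC.
rewrite !(hornerD, hornerN, hornerZ, hornerXn, hornerX, hornerC).
have algE (a : F) : a%:A = in_alg L a by [].
by rewrite !algE !(rmorphB, rmorphD) !rmorphXn !rmorphM.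
Qed.

Theorem theorem3p6 (p k q : nat) (F : finFieldType) (L : fieldExtType F)
    (A B C : F)
    (p_prime : prime p) (p_odd : odd p) (k_gt0 : (0 < k)%N)
    (q_def : q = (p ^ k)%N) (card_F : #|F| = q) (dim_L : \dim {:L} = 3%N)
    (A_neq0 : A != 0) (B_neq0 : B != 0)
    (A3 : A ^+ 3 != -1) (B3 : B ^+ 3 != -1)
    (ABC : C ^+ 2 - A * B - C + 1 = 0)
    (ABC_neq0 : A * B - C != 0)
    (AB1_neq0 : A + B + 1 != 0)
    (AB2_neq0 : A ^+ 2 - A * B - A + B ^+ 2 - B + 1 != 0)
    (m_noroot : forall x : L, x \in mu L (q ^ 2 + q + 1) ->
       ~~ root (map_poly (in_alg L) (m_poly A B C)) x) :
  permutation_poly (f_poly L q A B C).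
Proof.
have pcharF : p \in [pchar F] by apply: (card_finPcharP (n := k)); rewrite ?card_F.
have q_gt1 : (1 < q)%N by rewrite -card_F finNzRing_gt1.
(* A finite-dimensional space over the finite field [F] is finite, which gives [L] the structure of
   a finite field. *)
pose K : finFieldType := finvect_type L.
have pcharK : p \in [pchar K] by rewrite (pchar_lalg L).
have cardK : #|K| = (q ^ 3)%N.
  rewrite -(@card_vspacef F K (Vector.class (finvect_type L))) card_vspace card_F.
  by rewrite -dim_L.
have algX (a : F) : (a%:A : L) ^+ q = a%:A.
  by rewrite -[a%:A]/(in_alg L a) -rmorphXn -card_F expf_card.
have [] := @frobenius_map_bij K p k q p_prime q_def q_gt1 pcharK cardK
  A%:A B%:A C%:A (algX A) (algX B) (algX C).
- by rewrite -[A%:A]/(in_alg L A) fmorph_eq0.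
- move/(congr1 (in_alg L)): ABC.
  by rewrite rmorph0 rmorphD !rmorphB rmorphXn rmorphM rmorph1.
- move=> t t_mu; have := m_noroot t; rewrite inE t_mu eqxx => /(_ isT).
  by rewrite /root horner_m_poly.
- move=> g gK Kg; exists g => x; [rewrite -[RHS]gK | rewrite -[RHS]Kg];
    by rewrite /f_poly !(hornerD, hornerZ, hornerXn, hornerX).
Qed.
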